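(* Let $G$ be a finitely generated LERF group with positive rank gradient $\nabla G>0$, let $n\in\mathbb{N}$, and let $H_1,\dots,H_n$ be finitely generated subgroups of infinite index in $G$. Then $H_1H_2\cdots H_n\subsetneq G$, where $H_1H_2\cdots H_n=\{h_1h_2\cdots h_n : h_i\in H_i\}$.
   Context: For a group $U$, $d(U)$ denotes the minimal cardinality of a generating set of $U$. The rank gradient of a finitely generated group $G$ is $\nabla G=\inf_U \frac{d(U)-1}{[G:U]}$, where $U$ ranges over all finite index subgroups of $G$. A group $G$ is LERF (subgroup separable) if every finitely generated subgroup of $G$ is the intersection of some collection of finite index subgroups of $G$. *)

(* Defs.v *)
From mathcomp Require Import all_boot all_order all_algebra.
From mathcomp Require Import boolp classical_sets reals Rstruct.
From Stdlib Require Import List.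
Set Implicit Arguments. Unset Strict Implicit. Unset Printing Implicit Defensive.
Import Order.TTheory GRing.Theory Num.Theory.

Record group := Group {
  carrier :> Type;
  gmul : carrier -> carrier -> carrier;
  ginv : carrier -> carrier;
  gone : carrier;
  gmulA : forall x y z, gmul x (gmul y z) = gmul (gmul x y) z;
  gmul1l : forall x, gmul gone x = x;
  gmulVl : forall x, gmul (ginv x) x = gone
}.

Section GroupDefs.
Variable G : group.

Definition is_subgroup (U : G -> Prop) : Prop :=
  U (gone G) /\ (forall x y, U x -> U y -> U (gmul x y)) /\ (forall x, U x -> U (ginv x)).

Definition generated (s : list G) (g : G) : Prop :=
  forall K : G -> Prop, is_subgroup K -> (forall x, List.In x s -> K x) -> K g.

Definition generates (s : list G) (U : G -> Prop) : Prop :=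
  forall g, generated s g <-> U g.

Definition fin_gen (U : G -> Prop) : Prop := exists s : list G, generates s U.

Definition fin_gen_group : Prop := fin_gen (fun _ => True).

Definition has_index (U : G -> Prop) (n : nat) : Prop :=
  exists r : nat -> G, forall g, exists i, (i < n)%N /\ U (gmul (ginv (r i)) g) /\
     forall j, (j < n)%N -> U (gmul (ginv (r j)) g) -> j = i.

Definition finite_index (U : G -> Prop) : Prop := exists n, has_index U n.

Definition rank_is (U : G -> Prop) (k : nat) : Prop :=
  (exists s : list G, size s = k /\ generates s U) /\
  (forall s : list G, generates s U -> (k <= size s)%N).

Definition rank_gradient : Rdefinitions.R :=
  inf [set x : Rdefinitions.R | exists (U : G -> Prop) (n k : nat),
        is_subgroup U /\ has_index U n /\ rank_is U k /\
        x = ((k%:R - 1) / n%:R)%R].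

Definition LERF : Prop :=
  forall H : G -> Prop, is_subgroup H -> fin_gen H ->
    exists C : (G -> Prop) -> Prop,
      (forall K, C K -> is_subgroup K /\ finite_index K) /\
      (forall g, H g <-> (forall K, C K -> K g)).

Fixpoint prod_set (H : nat -> G -> Prop) (n : nat) : G -> Prop :=
  match n with
  | 0 => fun g => g = gone G
  | m.+1 => fun g => exists x h, prod_set H m x /\ H m h /\ g = gmul x h
  end.

End GroupDefs.

(* Main.v *)
From mathcomp Require Import all_fingroup.
Require Import Defs.
From mathcomp Require Import all_boot all_order all_algebra.
From mathcomp Require Import boolp classical_sets reals Rstruct.
From mathcomp Require Import zify.
Set Implicit Arguments. Unset Strict Implicit. Unset Printing Implicit Defensive.
Import Order.TTheory GRing.Theory Num.Theory.

(** Call a subgroup thin if it is finitely generated of infinite index. By LERF,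
    finitely many thin subgroups have images of arbitrarily small density in a
    suitable finite quotient [q] of [G]. If [A] and [B] are thin, then by
    Schreier's lemma [A ∩ ker q] and [B ∩ ker q] are generated by at most
    [d(A) |q(A)| + d(B) |q(B)|] elements in total, which is less than
    [∇G |q(G)|] when the densities are small; hence they generate, even after
    conjugating one of them, a subgroup of [ker q] of infinite index. So [A x B]
    is covered by finitely many two-sided translates [a C b] of thin subgroups.
    Sets with such a cover are therefore stable under multiplication by thin
    subgroups, while [G] is not such a set, again by density. *)

Lemma In_mem (T : eqType) (x : T) (s : list T) : List.In x s <-> x \in s.
Proof.
elim: s => //= y s IH; rewrite inE; split.
  by case=> [->|/IH ->]; rewrite ?eqxx ?orbT.
by case/predU1P => [->|/IH]; [left | right].
Qed.

(** * Elementary calculus in groups and subgroups *)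

Section GroupTheory.
Variable G : group.
Implicit Types (x y z g : G) (U C K : G -> Prop).

Lemma gmulVr x : gmul x (ginv x) = gone G.
Proof.
rewrite -[LHS]gmul1l -{1}(gmulVl (ginv x)) -gmulA (gmulA (ginv x)) gmulVl.
by rewrite gmul1l gmulVl.
Qed.

Lemma gmul1r x : gmul x (gone G) = x.
Proof. by rewrite -(gmulVl x) gmulA gmulVr gmul1l. Qed.

Lemma gmulKl x y : gmul (ginv x) (gmul x y) = y.
Proof. by rewrite gmulA gmulVl gmul1l. Qed.

Lemma gmulKVl x y : gmul x (gmul (ginv x) y) = y.
Proof. by rewrite gmulA gmulVr gmul1l. Qed.

Lemma ginv_uniq x y : gmul x y = gone G -> y = ginv x.
Proof. by move=> e; rewrite -(gmulKl x y) e gmul1r. Qed.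

Lemma ginvK x : ginv (ginv x) = x.
Proof. by rewrite -(ginv_uniq (gmulVl x)). Qed.

Lemma ginvM x y : ginv (gmul x y) = gmul (ginv y) (ginv x).
Proof.
symmetry; apply: ginv_uniq.
by rewrite -gmulA gmulKVl gmulVr.
Qed.

Lemma ginv1 : ginv (gone G) = gone G.
Proof. by symmetry; apply: ginv_uniq; rewrite gmul1l. Qed.

Definition gsimp := (gmulKl, gmulKVl, gmulVl, gmulVr, gmul1l, gmul1r, ginvK, ginvM).

Lemma sub1 U : is_subgroup U -> U (gone G). Proof. by case. Qed.
Lemma subM U x y : is_subgroup U -> U x -> U y -> U (gmul x y).
Proof. by case=> _ [h _]; apply: h. Qed.
Lemma subV U x : is_subgroup U -> U x -> U (ginv x).
Proof. by case=> _ [_ h]; apply: h. Qed.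
Lemma subVV U x : is_subgroup U -> U (ginv x) -> U x.
Proof. by move=> h hx; rewrite -(ginvK x); apply: subV. Qed.

Lemma generated_subgroup (s : list G) : is_subgroup (generated s).
Proof.
split; first by move=> K hK _; apply: sub1.
split=> [x y hx hy|x hx] K hK hs.
  by apply: subM => //; [apply: hx | apply: hy].
by apply: subV => //; apply: hx.
Qed.

Lemma generated_in (s : list G) x : List.In x s -> generated s x.
Proof. by move=> hx K _; apply. Qed.

Lemma subgroup_conj U x : is_subgroup U ->
  is_subgroup (fun y => U (gmul x (gmul y (ginv x)))).
Proof.
move=> hU; split; first by rewrite gsimp gmulVr; apply: sub1.
split=> [y z hy hz|y hy].
  by have := subM hU hy hz; rewrite -!gmulA gmulKl.
by have := subV hU hy; rewrite !ginvM ginvK -!gmulA.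
Qed.

(* Otherwise a maximal family of pairwise inequivalent elements would be a
   transversal. *)
Lemma infinite_index_inequiv U M : is_subgroup U -> ~ finite_index U ->
  exists r : nat -> G, forall i j, (i < j < M)%N ->
    ~ U (gmul (ginv (r i)) (r j)).
Proof.
move=> hU hinf; elim: M => [|M [r hr]].
  by exists (fun=> gone G) => i j; rewrite ltn0 andbF.
have [[g hg]|hno] := pselect (exists g, forall i, (i < M)%N ->
    ~ U (gmul (ginv (r i)) g)).
  exists (fun k => if k == M then g else r k) => i j /andP[ij jM].
  have iM : (i < M)%N by lia.
  rewrite (ltn_eqF iM); case: eqVneq => jE; first exact: hg.
  by apply: hr; lia.
case: hinf; exists M, r => g.
have [i [iM hi]] : exists i, (i < M)%N /\ U (gmul (ginv (r i)) g).
  apply: contrapT => hn; apply: hno; exists g => i iM hi.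
  by apply: hn; exists i.
exists i; split => //; split => // j jM hj.
have e a b : U (gmul (ginv (r a)) g) -> U (gmul (ginv (r b)) g) ->
    U (gmul (ginv (r a)) (r b)).
  move=> ha hb; have := subM hU ha (subV hU hb).
  by rewrite ginvM ginvK -gmulA gmulKVl.
have [ij|ji|//] := ltngtP i j.
  by case: (hr i j); [rewrite ij | apply: e].
by case: (hr j i); [rewrite ji | apply: e].
Qed.

(** * Finite quotients: densities of images, kernels and separation *)

Record finite_quotient := FiniteQuotient {
  fq_group : finGroupType;
  fq_map :> G -> fq_group;
  fq_mapM : forall x y, fq_map (gmul x y) = (fq_map x * fq_map y)%g
}.

Section FiniteQuotient.
Variable q : finite_quotient.

Lemma fq_map1 : q (gone G) = 1%g.
Proof. by apply: (mulgI (q (gone G))); rewrite -fq_mapM gmul1l mulg1. Qed.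

Lemma fq_mapV x : q (ginv x) = (q x)^-1%g.
Proof. by apply: (mulIg (q x)); rewrite -fq_mapM gmulVl fq_map1 mulVg. Qed.

(** The map [q] need not be onto, so the order of the quotient of [G] is the cardinality of
    [fq_image (fun=> True)] rather than of [fq_group q]. *)
Definition fq_image U : {set fq_group q} :=
  [set a | `[< exists g, U g /\ q g = a >]].

Lemma fq_imageP U a : reflect (exists g, U g /\ q g = a) (a \in fq_image U).
Proof. by rewrite inE; apply: asboolP. Qed.

Lemma mem_fq_image U g : U g -> q g \in fq_image U.
Proof. by move=> hg; apply/fq_imageP; exists g. Qed.

Definition fq_separates (p : (G -> Prop) * G) := ~ exists c, p.1 c /\ q c = q p.2.

(** The translates of [q(U)] by [q (r i)], for [i < M], are pairwise disjoint subsets of [q(G)],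
    each with as many elements as [q(U)]. *)
Lemma fq_image_index U (r : nat -> G) M : is_subgroup U ->
  (forall i j, (i < j < M)%N -> fq_separates (U, gmul (ginv (r i)) (r j))) ->
  (M * #|fq_image U| <= #|fq_image (fun=> True)|)%N.
Proof.
move=> hU hr.
pose f (p : 'I_M * fq_group q) := (q (r p.1) * p.2)%g.
have finj : {in finset.setX [set: 'I_M] (fq_image U) &, injective f}.
  have main (i j : 'I_M) a b : (i < j)%N -> a \in fq_image U ->
      b \in fq_image U -> f (i, a) <> f (j, b).
    move=> ij /fq_imageP[g [hg <-]] /fq_imageP[h [hh <-]] e.
    apply: (hr i j); first by rewrite ij ltn_ord.
    exists (gmul g (ginv h)); split; first by apply: subM => //; apply: subV.
    rewrite /= !fq_mapM !fq_mapV; apply: (mulgI (q (r i))).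
    by rewrite mulKVg mulgA [X in (X * _)%g]e mulgK.
  move=> [i a] [j b] /setXP[_ ha] /setXP[_ hb] e.
  have [ij|ij|/val_inj ij] := ltngtP i j.
  - by case: (main i j a b ij).
  - by case: (main j i b a ij).
  - by move: e; rewrite ij /f /= => /mulgI ->.
have := card_in_imset finj; rewrite cardsX cardsT card_ord => <-.
apply: subset_leq_card; apply/fintype.subsetP => _ /imsetP[[i a] /setXP[_ ha] ->].
case/fq_imageP: ha => g [_ /= <-]; rewrite /f /= -fq_mapM.
exact: mem_fq_image.
Qed.

(** Values outside the image default to the identity, so membership in [U] needs no side condition;
    [t 1] is normalised so that Schreier's rewriting returns a kernel element unchanged. *)
Lemma fq_transversal U : is_subgroup U -> exists t : fq_group q -> G,
  [/\ t 1%g = gone G, forall a, U (t a) &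
      forall a, a \in fq_image U -> q (t a) = a].
Proof.
move=> hU.
have [t ht] : exists t : fq_group q -> G, forall a, U (t a) /\
    (a \in fq_image U -> q (t a) = a).
  suff /choice[t ht] : forall a, exists x, U x /\ (a \in fq_image U -> q x = a).
    by exists t.
  move=> a.
  have [/fq_imageP[g [hg e]]|_] := boolP (a \in fq_image U); first by exists g.
  by exists (gone G); split => //; apply: sub1.
exists (fun a => if a == 1%g then gone G else t a); split=> [|a|a].
- by rewrite eqxx.
- by case: eqP => _; [apply: sub1 | case: (ht a)].
- by case: eqP => [-> _|_]; [apply: fq_map1 | case: (ht a)].
Qed.

Definition fq_kernel U g := U g /\ q g = 1%g.

(* Schreier's lemma: the generators are [t a * x * (t (a * q x))^-1] for a
   transversal [t]. *)
Lemma fq_kernel_generates (s : list G) U : is_subgroup U -> generates s U ->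
  exists s' : list G, size s' = (#|fq_image U| * size s)%N /\
    generates s' (fq_kernel U).
Proof.
move=> hU hs; have [t [t1 tU tq]] := fq_transversal hU.
pose gen a x := gmul (t a) (gmul x (ginv (t (a * q x)%g))).
pose s' := List.map (fun p => gen p.1 p.2) (List.list_prod (enum (fq_image U)) s).
exists s'; split.
  by rewrite cardE; transitivity (length s') => //; rewrite List.length_map List.length_prod.
have hsU x : List.In x s -> U x by move=> hx; apply/hs; apply: generated_in.
have imM a g : a \in fq_image U -> U g -> (a * q g)%g \in fq_image U.
  move=> /fq_imageP[h [hh <-]] hg; rewrite -fq_mapM.
  by apply: mem_fq_image; apply: subM.
have hs' y : List.In y s' <-> exists a x, [/\ a \in fq_image U, List.In x s &
    y = gen a x].
  rewrite List.in_map_iff; split.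
    move=> [[a x] [<- /List.in_prod_iff[/In_mem + hx]]]; rewrite mem_enum => ha.
    by exists a, x.
  move=> [a [x [ha hx ->]]]; exists (a, x); split=> //.
  by apply/List.in_prod_iff; split=> //; apply/In_mem; rewrite mem_enum.
have hD := generated_subgroup s'.
move=> g; split.
  apply.
    split; first by split; [apply: sub1 | rewrite fq_map1].
    split=> [x y [hx qx] [hy qy]|x [hx qx]].
      by split; [apply: subM | rewrite fq_mapM qx qy mulg1].
    by split; [apply: subV | rewrite fq_mapV qx invg1].
  move=> x /hs' [a [y [ha hy ->]]].
  split; first by apply: subM => //; apply: subM; [|apply: hsU|apply: subV].
  rewrite /gen !fq_mapM fq_mapV !tq //; first by rewrite mulgA mulgV.
  by apply: imM => //; apply: hsU.
move=> [/hs hg qg].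
(* The elements whose rewriting from every coset lands in the group generated by [s'] form a
   subgroup containing [s], hence all of [U]. Starting from the coset [1], the rewriting of [g] is
   [g] itself. *)
pose K x := U x /\ forall a, a \in fq_image U -> generated s' (gen a x).
have hK : is_subgroup K.
  split.
    split; first exact: sub1.
    by move=> a _; rewrite /gen fq_map1 mulg1 !gsimp; apply: sub1.
  split=> [x y [hx gx] [hy gy]|x [hx gx]].
    split=> [|a ha]; first exact: subM.
    have := subM hD (gx a ha) (gy _ (imM a x ha hx)).
    by rewrite /gen fq_mapM -!gmulA gmulKl mulgA.
  split=> [|a ha]; first exact: subV.
  have := subV hD (gx _ (imM _ _ ha (subV hU hx))).
  by rewrite /gen !ginvM !ginvK -!gmulA fq_mapV mulgKV.
have [] : K g.
  apply: hg => // x hx; split; first exact: hsU.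
  by move=> a ha; apply: generated_in; apply/hs'; exists a, x.
move=> _ /(_ 1%g); rewrite /gen qg mulg1 t1 !gsimp ginv1 gmul1r; apply.
by rewrite -fq_map1; apply: mem_fq_image; apply: sub1.
Qed.

(** As [U] lies in the kernel, [q] is constant on each coset of [U], so all its values are among the
    [q (r i)]. *)
Lemma fq_card_le_index U n : has_index U n -> (forall g, U g -> q g = 1%g) ->
  (#|fq_image (fun=> True)| <= n)%N.
Proof.
move=> [r hr] hU; pose f (i : 'I_n) := q (r i).
apply: (@leq_trans #|f @: [set: 'I_n]|).
  apply: subset_leq_card; apply/fintype.subsetP => _ /fq_imageP[g [_ <-]].
  have [i [iN [/hU hi _]]] := hr g.
  apply/imsetP; exists (Ordinal iN) => //.
  by move: hi; rewrite fq_mapM fq_mapV => /(canRL (mulKVg _)); rewrite mulg1.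
by rewrite (leq_trans (leq_imset_card _ _)) // cardsT card_ord.
Qed.

End FiniteQuotient.

Definition trivial_finite_quotient : finite_quotient :=
  @FiniteQuotient {perm bool} (fun=> 1%g) (fun _ _ => esym (mulg1 _)).

(** Equal images in the product quotient are equal in both factors. *)
Lemma fq_prod (q q' : finite_quotient) : exists q'' : finite_quotient,
  forall p, fq_separates q p \/ fq_separates q' p -> fq_separates q'' p.
Proof.
have fM x y : (q (gmul x y), q' (gmul x y)) = ((q x, q' x) * (q y, q' y))%g.
  by rewrite !fq_mapM.
exists (@FiniteQuotient (fq_group q * fq_group q')%type _ fM) => p.
by move=> [] h [c [hc [e1 e2]]]; apply: h; exists c.
Qed.

(* The quotient is the permutation action of [G] on the cosets of [K]; the
   inverse turns the left action into a right one, as composition of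
   permutations requires. *)
Lemma finite_index_separates K g : is_subgroup K -> finite_index K -> ~ K g ->
  exists q : finite_quotient, forall U, (forall x, U x -> K x) ->
    fq_separates q (U, g).
Proof.
move=> hK [n [r hr]] hg.
have [idx hidx] : exists idx : G -> 'I_n, forall x j,
    (K (gmul (ginv (r j)) x) /\ (j < n)%N) <-> j = idx x.
  suff /choice[idx hidx] : forall x, exists i : 'I_n, forall j,
      (K (gmul (ginv (r j)) x) /\ (j < n)%N) <-> j = i by exists idx.
  move=> x.
  have [i [iN [hi hu]]] := hr x; exists (Ordinal iN) => j /=; split.
    by move=> [hj jN]; apply: hu.
  by move=> ->.
have idxK x : K (gmul (ginv (r (idx x))) x) by have [_ []] := hidx x (idx x).
have idx_eq x y : K (gmul (ginv x) y) -> idx x = idx y.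
  move=> hxy; apply/val_inj/hidx; split; last exact: ltn_ord.
  by have := subM hK (idxK x) hxy; rewrite -!gmulA gmulKVl.
have idx_inj x y : idx x = idx y -> K (gmul (ginv x) y).
  move=> e; have := idxK y; rewrite -e => h.
  have := subM hK (subV hK (idxK x)) h.
  by rewrite ginvM ginvK -!gmulA gmulKVl.
pose f x (i : 'I_n) := idx (gmul (ginv x) (r i)).
have f_idx x y : f x (idx y) = idx (gmul (ginv x) y).
  by apply: idx_eq; rewrite ginvM ginvK -!gmulA gmulKVl; apply: idxK.
have idx_r (i : 'I_n) : idx (r i) = i.
  apply/val_inj/esym/hidx; rewrite gmulVl.
  by split; [apply: sub1 | apply: ltn_ord].
have fK x : cancel (f x) (f (ginv x)).
  by move=> i; rewrite {2}/f f_idx ginvK gmulKVl idx_r.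
pose phi x := perm (can_inj (fK x)).
have phiM x y : phi (gmul x y) = (phi x * phi y)%g.
  by apply/perm.permP => i; rewrite permM !permE [f x i]/f f_idx /f ginvM -gmulA.
exists (FiniteQuotient phiM) => U hUK [c [/= /hUK hc e]].
(* Evaluate at the coset of the identity: [phi c] fixes it because [c] is in [K], so [phi g] fixes
   it too, which forces [g] into [K]. *)
have /perm.permP/(_ (idx (gone G))) := e; rewrite !permE !f_idx !gmul1r.
have <- : idx (gone G) = idx (ginv c) by apply: idx_eq; rewrite ginv1 gmul1l; apply: subV.
move=> /idx_inj; rewrite ginv1 gmul1l => h.
by apply: hg; apply: subVV.
Qed.

Definition thin_subgroup U := is_subgroup U /\ fin_gen U /\ ~ finite_index U.

(** * Separation by LERF, and sets covered by translates of thin subgroups *)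

Section Separation.
Hypothesis hLERF : LERF G.

(** For each pair, LERF gives a finite index subgroup containing [U] and missing [g]; the product of
    the resulting quotients separates all pairs. *)
Lemma LERF_separates (l : list ((G -> Prop) * G)) :
  (forall p, List.In p l -> thin_subgroup p.1 /\ ~ p.1 p.2) ->
  exists q : finite_quotient, forall p, List.In p l -> fq_separates q p.
Proof.
elim: l => [|[U g] l IH] hl; first by exists trivial_finite_quotient.
have [|q1 h1] := IH; first by move=> p hp; apply: hl; right.
have [[hU [fgU _]] /= hg] := hl (U, g) (or_introl erefl).
have [C [hC hUC]] := hLERF hU fgU.
have [K [CK hKg]] : exists K, C K /\ ~ K g.
  apply: contrapT => hn; apply: hg; apply/hUC => K CK.
  by apply: contrapT => hK; apply: hn; exists K.
have [hK fK] := hC K CK.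
have [q2 h2] := finite_index_separates hK fK hKg.
have [q hq] := fq_prod q1 q2; exists q => p [<-|hp]; apply: hq.
  by right; apply: h2 => x /hUC; apply.
by left; apply: h1.
Qed.

Lemma thin_density (l : list (G -> Prop)) M :
  (forall U, List.In U l -> thin_subgroup U) ->
  exists q : finite_quotient, forall U, List.In U l ->
    (M * #|fq_image q U| <= #|fq_image q (fun=> True)|)%N.
Proof.
move=> hl.
(* The pairs to separate are listed before any quotient is chosen, so that one quotient serves every
   [U] in [l]. They are the [(U, r_i^-1 r_j)] with [i < j < M], for elements [r_i] in distinct
   cosets of [U]. *)
suff [s [hs hsq]] : exists s : list ((G -> Prop) * G),
    (forall p, List.In p s -> thin_subgroup p.1 /\ ~ p.1 p.2) /\
    forall q : finite_quotient, (forall p, List.In p s -> fq_separates q p) ->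
    forall U, List.In U l ->
    (M * #|fq_image q U| <= #|fq_image q (fun=> True)|)%N.
  by have [q hq] := LERF_separates hs; exists q; apply: hsq.
elim: l hl => [|U l IH] hl; first by exists [::].
have [|s [hs hsq]] := IH; first by move=> V hV; apply: hl; right.
have thU := hl U (or_introl erefl); have [hU [_ infU]] := thU.
have [r hr] := infinite_index_inequiv M hU infU.
pose s' := [seq (U, gmul (ginv (r p.1)) (r p.2)) | p <-
  List.filter (fun p : nat * nat => p.1 < p.2)%N
    (List.list_prod (List.seq 0 M) (List.seq 0 M))].
exists (s' ++ s); split.
  move=> p /List.in_app_iff[|/hs//] /List.in_map_iff[[i j] [<-]].
  move=> /List.filter_In[/List.in_prod_iff[_ /List.in_seq hj] /= ij].
  by split=> //; apply: hr; rewrite ij /=; lia.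
move=> q hq V [<-|hV]; last first.
  by apply: hsq => // p hp; apply: hq; apply/List.in_app_iff; right.
apply: (fq_image_index hU (r := r)) => i j ij; apply: hq.
apply/List.in_app_iff; left; apply/List.in_map_iff; exists (i, j); split=> //.
case/andP: ij => ij jM; apply/List.filter_In; split=> //.
by apply/List.in_prod_iff; split; apply/List.in_seq; lia.
Qed.

(** The translates are two-sided because covering [A x B] produces a factor on each side of the thin
    subgroup. *)
Definition small (S : G -> Prop) := exists l : list (G * (G -> Prop) * G),
  (forall t, List.In t l -> thin_subgroup t.1.2) /\
  forall g, S g -> exists t c, [/\ List.In t l, t.1.2 c &
    g = gmul t.1.1 (gmul c t.2)].

Lemma small_bigcup (T : Type) (l : list T) (S : T -> G -> Prop) :
  (forall t, List.In t l -> small (S t)) ->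
  small (fun g => exists t, List.In t l /\ S t g).
Proof.
elim: l => [|t l IH] hl; first by exists [::]; split => // g [t [[]]].
have [|s [hs hsS]] := IH; first by move=> u hu; apply: hl; right.
have [s' [hs' hs'S]] := hl t (or_introl erefl).
exists (s' ++ s); split; first by move=> u /List.in_app_iff[/hs'|/hs].
move=> g [u [[<-|hu] hg]].
  have [v [c [hv hc ->]]] := hs'S _ hg; exists v, c; split=> //.
  by apply/List.in_app_iff; left.
have [v [c [hv hc ->]]] := hsS g (ex_intro _ u (conj hu hg)); exists v, c.
by split=> //; apply/List.in_app_iff; right.
Qed.

Lemma small_not_full : ~ small (fun=> True).
Proof.
move=> [l [hl hcov]].
(* With this density, each of the [size l] translates fills at most [1/(size l + 1)] of [q(G)], so
   together they cannot cover it. *)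
have [|q hq] := @thin_density (List.map (fun t => t.1.2) l) (size l).+1.
  by move=> U /List.in_map_iff[t [<- /hl]].
set N := #|fq_image q (fun=> True)| in hq.
have N0 : (0 < N)%N.
  by apply/card_gt0P; exists (q (gone G)); apply: mem_fq_image.
have hle (S : G -> Prop) (s : list (G * (G -> Prop) * G)) :
    (forall t, List.In t s -> List.In t l) ->
    (forall g, S g -> exists t c, [/\ List.In t s, t.1.2 c &
      g = gmul t.1.1 (gmul c t.2)]) ->
    ((size l).+1 * #|fq_image q S| <= size s * N)%N.
  elim: s S => [|t s IH] S hs hS.
    rewrite (_ : fq_image q S = finset.set0) ?cards0 ?muln0 //.
    apply/setP => a; rewrite finset.in_set0; apply/negP => /fq_imageP[g [/hS]].
    by move=> [t [c []]].
  pose S' g := exists t c, [/\ List.In t s, t.1.2 c &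
      g = gmul t.1.1 (gmul c t.2)].
  have h1 := IH S' (fun t ht => hs t (or_intror ht)) (fun g h => h).
  have h2 : ((size l).+1 * #|fq_image q t.1.2| <= N)%N.
    by apply: hq; apply: (List.in_map (fun t => t.1.2)); apply: hs; left.
  pose f a := (q t.1.1 * (a * q t.2))%g.
  have h3 : (#|fq_image q S| <= #|fq_image q t.1.2| + #|fq_image q S'|)%N.
    apply: (@leq_trans #|f @: fq_image q t.1.2 :|: fq_image q S'|).
      apply: subset_leq_card; apply/fintype.subsetP => _ /fq_imageP[g [/hS hg <-]].
      rewrite finset.in_setU; apply/orP.
      have [u [c [[<-|hu] hc ->]]] := hg.
        left; apply/imsetP; exists (q c); first exact: mem_fq_image.
        by rewrite !fq_mapM.
      by right; apply: mem_fq_image; exists u, c.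
    by rewrite (leq_trans (leq_card_setU _ _)) // leq_add2r leq_imset_card.
  rewrite /= [leqRHS]mulSn; apply: leq_trans (leq_add h2 h1).
  by rewrite -mulnDr leq_mul2l h3 orbT.
have := hle (fun=> True) l (fun _ h => h) hcov.
by rewrite leq_pmul2r // ltnn.
Qed.

(** * Positive rank gradient and products with thin subgroups *)

Section RankGradient.
Hypothesis hrg : (0 < rank_gradient G)%R.

(** A shortest generating list is no longer than [s], and its ratio is one of the numbers whose
    infimum is taken. *)
Lemma rank_gradient_le (s : list G) U n : is_subgroup U -> generates s U ->
  has_index U n -> (rank_gradient G * n%:R <= (size s)%:R - 1)%R.
Proof.
move=> hU hs hn.
have n0 : (0 < n)%N by case: hn => r /(_ (gone G)) [i [+ _]]; lia.
have hex : exists k, `[< exists s', size s' = k /\ generates s' U >].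
  by exists (size s); apply/asboolP; exists s.
have [k /asboolP hk hmin] := find_ex_minn hex.
have rk : rank_is U k.
  by split=> // s' hs'; apply: hmin; apply/asboolP; exists s'.
have ks : (k <= size s)%N by case: rk => _; apply.
rewrite -ler_pdivlMr ?ltr0n //.
apply: (@le_trans _ _ ((k%:R - 1) / n%:R)%R); last first.
  by rewrite ler_pM2r ?invr_gt0 ?ltr0n // lerD2r ler_nat.
apply: ge_inf; last by exists U, n, k.
(* The infimum bounds its members only for a set bounded below; [-1] is a bound, also at [m = 0],
   where division by zero gives [0]. *)
exists (-1)%R => x [V [m [j [_ [_ [_ ->]]]]]].
case: m => [|m]; first by rewrite invr0 mulr0 lerN10.
rewrite ler_pdivlMr ?ltr0n // mulN1r lerBrDr.
rewrite (@le_trans _ _ 0%R) ?ler0n // -subr_ge0 sub0r opprD opprK.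
by rewrite subr_ge0 ler1n.
Qed.

(** The trivial subgroup is itself thin: its generating list is empty, so a finite index [n] would
    give [rank_gradient G * n <= -1]. *)
Lemma small1 : small (fun g => g = gone G).
Proof.
exists [:: (gone G, fun g => g = gone G, gone G)]; split.
  move=> _ [<-|[]] /=.
  have h1 : is_subgroup (fun g : G => g = gone G).
    by split=> //; split=> [x y -> ->|x ->]; [rewrite gmul1l | rewrite ginv1].
  have hgen : generates [::] (fun g : G => g = gone G).
    move=> g; split=> [/(_ _ h1)|->]; first by apply=> x [].
    by apply: sub1; apply: generated_subgroup.
  split=> //; split; first by exists [::].
  move=> [n hn]; have := rank_gradient_le h1 hgen hn.
  by apply/negP; rewrite -ltNge sub0r (lt_le_trans (ltrN10 _)) // mulr_ge0 ?ler0n // ltW.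
move=> g ->; exists (gone G, fun g => g = gone G, gone G), (gone G).
by split; [left | | rewrite /= !gmul1l].
Qed.

(* In a quotient in which the images of [A] and [B] have small density, the
   subgroup generated by the traces of [A] and [x B x^-1] on the kernel has too
   few generators to be of finite index. *)
Lemma small_AxB A B x : thin_subgroup A -> thin_subgroup B ->
  small (fun g => exists a b, [/\ A a, B b & g = gmul a (gmul x b)]).
Proof.
move=> thA thB; have [hA [[sA gA] _]] := thA; have [hB [[sB gB] _]] := thB.
set m := (size sA + size sB)%N.
pose M := (Num.bound (m%:R / rank_gradient G)%R).
have hM : (m%:R < rank_gradient G * M%:R)%R.
  by rewrite mulrC -ltr_pdivrMr // archi_boundP // divr_ge0 ?ler0n // ltW.
have [|q hq] := @thin_density [:: A; B] M; first by move=> U [<-|[<-|[]]].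
have qA := hq A (or_introl erefl).
have qB := hq B (or_intror (or_introl erefl)).
have [sA0 [zA gA0]] := fq_kernel_generates q hA gA.
have [sB0 [zB gB0]] := fq_kernel_generates q hB gB.
pose cj y := gmul x (gmul y (ginv x)).
pose s := sA0 ++ List.map cj sB0.
pose C := generated s.
have hC : is_subgroup C by apply: generated_subgroup.
have sizes : size s = (size sA0 + size sB0)%N.
  by rewrite size_cat; congr addn; apply: List.length_map.
have Cker g : C g -> q g = 1%g.
  move=> /(_ (fun g => q g = 1%g)); apply.
    split; first exact: fq_map1.
    split=> [y z hy hz|y hy]; first by rewrite fq_mapM hy hz mulg1.
    by rewrite fq_mapV hy invg1.
  move=> y /List.in_app_iff[/generated_in/gA0[]//|/List.in_map_iff[z [<-]]].
  move=> /generated_in/gB0[_ hz].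
  by rewrite /cj !fq_mapM hz mul1g fq_mapV mulgV.
have thC : thin_subgroup C.
  split=> //; split; first by exists s.
  move=> [n hn]; have hr := rank_gradient_le hC (fun g => iff_refl (C g)) hn.
  have hN := fq_card_le_index hn Cker.
  set N := #|fq_image q (fun=> True)| in qA qB hN.
  have n0 : (0 < n)%N by case: hn => r /(_ (gone G)) [i [+ _]]; lia.
  (* Schreier's count and [N <= n] give this bound, whereas the rank gradient and the choice of [M]
     force [m * n < M * size s]. *)
  have hMs : (M * size s <= m * n)%N.
    rewrite /m sizes zA zB mulnDr !mulnA mulnDl.
    apply: leq_add; rewrite mulnC leq_mul2l; apply/orP; right.
      exact: leq_trans qA hN.
    exact: leq_trans qB hN.
  have : (m%:R * n%:R < M%:R * (size s)%:R :> Rdefinitions.R)%R.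
    apply: (@lt_le_trans _ _ (rank_gradient G * M%:R * n%:R)%R).
      by rewrite ltr_pM2r ?ltr0n.
    rewrite mulrAC mulrC; apply: ler_wpM2l; first exact: ler0n.
    by apply: le_trans hr _; rewrite gerBl ler01.
  by rewrite -!natrM ltr_nat ltnNge hMs.
have [tA [_ tAA tAq]] := fq_transversal q hA.
have [tB [_ tBB tBq]] := fq_transversal q hB.
have in_enum (a : fq_group q) : List.In a (enum (fq_group q)).
  by apply/In_mem; rewrite mem_enum.
(* Write [a = t a0] and [b = b0 t'] with [a0], [b0] in the kernel of [q]; then
   [a x b = t (a0 (x b0 x^-1)) (x t')], with finitely many pairs [(t, t')]. *)
exists (List.map (fun p => (tA p.1, C, gmul x (tB p.2)))
  (List.list_prod (enum (fq_group q)) (enum (fq_group q)))).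
split; first by move=> t /List.in_map_iff[p [<- _]].
move=> g [a [b [ha hb ->]]].
pose a0 := gmul (ginv (tA (q a))) a.
pose b0 := gmul b (ginv (tB (q b))).
exists (tA (q a), C, gmul x (tB (q b))), (gmul a0 (cj b0)); split=> /=.
- apply/List.in_map_iff; exists (q a, q b); split=> //.
  exact/List.in_prod_iff.
- apply: (subM hC).
    have : fq_kernel q A a0.
      split; first by apply: subM => //; apply: subV.
      by rewrite fq_mapM fq_mapV tAq ?mulVg //; apply: mem_fq_image.
    move=> /gA0; apply=> // y hy; apply: generated_in.
    by apply/List.in_app_iff; left.
  have : fq_kernel q B b0.
    split; first by apply: subM => //; apply: subV.
    by rewrite fq_mapM fq_mapV tBq ?mulgV //; apply: mem_fq_image.
  (* The elements whose conjugate by [x] lies in [C] form a subgroup containing [sB0], hence the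
     whole trace of [B] on the kernel. *)
  move=> /gB0/(_ (fun y => C (cj y))); apply; first exact: subgroup_conj.
  move=> y hy; apply: generated_in; apply/List.in_app_iff; right.
  exact: (List.in_map cj).
- by rewrite /cj /a0 /b0 -!gmulA !gmulKVl gmulKl gmulVl gmul1r.
Qed.

Lemma small_translate S x : small S ->
  small (fun g => exists2 h, S h & g = gmul x h).
Proof.
move=> [l [hl hS]].
exists (List.map (fun t => (gmul x t.1.1, t.1.2, t.2)) l); split.
  by move=> t /List.in_map_iff[u [<- /hl]].
move=> g [h /hS[t [c [ht hc ->]]] ->].
exists (gmul x t.1.1, t.1.2, t.2), c; split=> //=; last by rewrite -!gmulA.
exact: (List.in_map (fun t => (gmul x t.1.1, t.1.2, t.2))).
Qed.

Lemma small_sub S S' : (forall g, S g -> S' g) -> small S' -> small S.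
Proof. by move=> h [l [hl hS]]; exists l; split=> // g /h/hS. Qed.

(** A translate [t.1.1 A t.2] times [B] is [t.1.1 (A t.2 B)], and [small_AxB] applies with middle
    element [t.2]. *)
Lemma small_mul S B : small S -> thin_subgroup B ->
  small (fun g => exists x h, S x /\ B h /\ g = gmul x h).
Proof.
move=> [l [hl hS]] thB.
pose F (t : G * (G -> Prop) * G) g := exists2 h,
  (exists a b, [/\ t.1.2 a, B b & h = gmul a (gmul t.2 b)]) &
  g = gmul t.1.1 h.
apply: (@small_sub _ (fun g => exists t, List.In t l /\ F t g)).
  move=> g [x [h [/hS[t [c [ht hc ->]]] [hh ->]]]].
  exists t; split=> //; exists (gmul c (gmul t.2 h)); first by exists c, h.
  by rewrite -!gmulA.
by apply: small_bigcup => t /hl ht; apply: small_translate; apply: small_AxB.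
Qed.

End RankGradient.
End Separation.
End GroupTheory.

Theorem theorem1p2 (G : group) (n : nat) (H : nat -> G -> Prop) :
  fin_gen_group G -> LERF G -> (0 < rank_gradient G)%R ->
  (forall i, (i < n)%N -> is_subgroup (H i) /\ fin_gen (H i) /\ ~ finite_index (H i)) ->
  exists g : G, ~ prod_set H n g.
Proof.
move=> _ hL hr hH.
have hsm : small (prod_set H n).
  elim: n hH => [|n IH] hH /=; first exact: small1.
  by apply: small_mul => //; [apply: IH => i hi; apply: hH; lia | apply: hH].
apply: contrapT => hn; apply: (small_not_full hL); apply: small_sub hsm => g _.
by apply: contrapT => hg; apply: hn; exists g.
Qed.
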